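(* Let $\Omega\subset\mathbb{R}^2$ be a region of finite area $|\Omega|$ and let $T\subset\Omega$ be a convex polygon with area $|T|$ and perimeter length $L(T)$. Fix $r_{max}>0$ and assume that every point within distance $r_{max}$ of $T$ lies in $\Omega$. A directional distance sensor is placed at a location $(x,y)$ uniformly distributed in $\Omega$ with direction $\theta$ uniformly distributed in $[0,2\pi)$, independently. Its measured distance is $s=\min\{t\in[0,r_{max}] : (x+t\cos\theta,\,y+t\sin\theta)\in T\}$ if this set is nonempty, and $s=\emptyset$ (no detection) otherwise. Then for every $0\le r\le r_{max}$, $$\Pr(s\le r)=\frac{r\,L(T)+\pi |T|}{\pi |\Omega|},$$ where the event $s\le r$ excludes the no-detection outcome.
   Context: In particular $s=0$ when the sensor lies in $T$. Probabilities are geometric probabilities: the probability of a set $X$ of sensor positions $(x,y,\theta)$ equals $\iiint_X dx\,dy\,d\theta/(2\pi|\Omega|)$. *)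

(* Defs.v *)
From HB Require Import structures.
From mathcomp Require Import all_boot all_order all_algebra.
From mathcomp Require Import all_classical all_reals all_analysis.
Set Implicit Arguments. Unset Strict Implicit. Unset Printing Implicit Defensive.
Import Order.TTheory GRing.Theory Num.Theory.
Import numFieldNormedType.Exports.
Local Open Scope classical_set_scope.
Local Open Scope ring_scope.

Section Defs.
Variable R : realType.

Definition dist2 (p q : R * R) : R :=
  Num.sqrt ((p.1 - q.1) ^+ 2 + (p.2 - q.2) ^+ 2).

Definition cross3 (a b c : R * R) : R :=
  (b.1 - a.1) * (c.2 - a.2) - (b.2 - a.2) * (c.1 - a.1).

(* v 0, ..., v (n-1) are the vertices of a (non-degenerate) convex polygon,
   listed counterclockwise: every other vertex lies strictly to the left
   of each directed edge v i -> v ((i+1) mod n). *)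
Definition convex_polygon_vertices (n : nat) (v : nat -> R * R) : Prop :=
  (3 <= n)%N /\
  forall i j, (i < n)%N -> (j < n)%N -> j <> i -> j <> ((i.+1) %% n)%N ->
    0 < cross3 (v i) (v ((i.+1) %% n)%N) (v j).

Definition polygon (n : nat) (v : nat -> R * R) : set (R * R) :=
  [set p | exists w : nat -> R,
     (forall i, 0 <= w i) /\ \sum_(i < n) w i = 1 /\
     p = (\sum_(i < n) w i * (v i).1, \sum_(i < n) w i * (v i).2)].

Definition perimeter (n : nat) (v : nat -> R * R) : R :=
  \sum_(i < n) dist2 (v i) (v ((i.+1) %% n)%N).

Definition area (A : set (R * R)) : \bar R :=
  ((@lebesgue_measure R) \x (@lebesgue_measure R))%E A.

Definition vol3 (A : set ((R * R) * R)) : \bar R :=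
  ((((@lebesgue_measure R) \x (@lebesgue_measure R))%E) \x (@lebesgue_measure R))%E A.

Definition hit_set (T : set (R * R)) (rmax : R) (p : R * R) (th : R) : set R :=
  [set t | 0 <= t <= rmax /\
           T (p.1 + t * cos th, p.2 + t * sin th)].

Definition detect_le (T : set (R * R)) (rmax r : R) (p : R * R) (th : R) : Prop :=
  exists s, hit_set T rmax p th s /\
            (forall t, hit_set T rmax p th t -> s <= t) /\ s <= r.

Definition prob_detect_le (Omega T : set (R * R)) (rmax r : R) : \bar R :=
  (vol3 [set z | Omega z.1 /\ (0 <= z.2 < 2 * pi)%R /\ detect_le T rmax r z.1 z.2]
   / ((2 * pi)%:E * area Omega))%E.

End Defs.

(* Main.v *)
Require Import Defs.
From HB Require Import structures.
From mathcomp Require Import all_boot all_order all_algebra.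
From mathcomp Require Import all_classical all_reals all_analysis.
From mathcomp Require Import measurable_realfun.
From mathcomp Require Import ring lra.
Import Order.TTheory GRing.Theory Num.Theory.
Import numFieldNormedType.Exports.
Local Open Scope classical_set_scope.
Local Open Scope ring_scope.

(** For a fixed direction th, the positions that detect a compact convex set T
    within distance r form the sweep of T by a segment of length r.  Along a
    line of direction th, parametrized by its abscissa, T meets the line in a
    segment, which the sweep lengthens by r |cos th|; by Cavalieri, the sweep
    exceeds T in area by r times the width of T across th.  Each height of a
    convex polygon, but the lowest, is crossed upwards by exactly one edge, so
    that this width is half the total length of the projected edges.
    Integrating |a cos th + b sin th| over a period gives 4 |(a, b)|, whence
    the total volume 2 pi |T| + 2 r L(T). *)

Set Implicit Arguments.
Unset Strict Implicit.
Unset Printing Implicit Defensive.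

Section convex_sets.
Variables (R : realFieldType) (V : lmodType R).
Implicit Types (A : set V) (p q d : V).

Lemma convex_set_comb A p q (t : R) : convex_set A -> A p -> A q ->
  0 <= t -> t <= 1 -> A (t *: p + (1 - t) *: q).
Proof.
move=> cA Ap Aq t0 t1.
by have /set_mem := cA _ _ (Itv01 t0 t1) (mem_set Ap) (mem_set Aq); exact.
Qed.

Lemma is_interval_line_section A p d : convex_set A ->
  is_interval [set t : R | A (p + t *: d)].
Proof.
move=> cA x y /= Ax Ay z /andP[].
rewrite le_eqVlt => /predU1P[<-//|xz] zy.
have yx_gt0 : 0 < y - x by lra.
have -> : p + z *: d = (y - z) / (y - x) *: (p + x *: d) +
    (1 - (y - z) / (y - x)) *: (p + y *: d).
  rewrite !scalerDr addrACA !scalerA -!scalerDl addrCA subrr addr0 scale1r.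
  by congr (_ + _ *: _); field; rewrite gt_eqF.
apply: convex_set_comb => //; first by rewrite divr_ge0//; lra.
by rewrite ler_pdivrMr//; lra.
Qed.

Lemma is_interval_linear_image (f : {scalar V}) A : convex_set A ->
  is_interval (f @` A).
Proof.
move=> cA _ _ [p Ap <-] [q Aq <-] y /andP[].
rewrite le_eqVlt => /predU1P[<- _|py yq]; first by exists p.
have pq_gt0 : 0 < f q - f p by lra.
exists (p + ((y - f p) / (f q - f p)) *: (q - p)); last first.
  by rewrite linearD linearZ/= linearB/= divfK ?gt_eqF// addrC subrK.
have line_itv := is_interval_line_section (p := p) (d := q - p) cA.
apply: (line_itv 0 1) => /=.
- by rewrite scale0r addr0.
- by rewrite scale1r addrC subrK.
- by apply/andP; split; [rewrite divr_ge0//; lra|rewrite ler_pdivrMr//; lra].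
Qed.

End convex_sets.

Section cyclic_sequences.
Variables (d : Order.disp_t) (T : orderType d) (n : nat).

Lemma sum_cyclic_next (V : nmodType) (f : nat -> V) :
  \sum_(i < n) f (i.+1 %% n)%N = \sum_(i < n) f i.
Proof. by rewrite [RHS](reindex_inj (@ordS_inj n)). Qed.

Lemma cyclic_upcrossing (h : nat -> T) i j y : (i < n)%N -> (j < n)%N ->
  (h i < y)%O -> (y <= h j)%O ->
  exists2 k, (k < n)%N & (h k < y <= h (k.+1 %% n)%N)%O.
Proof.
move=> i_lt j_lt hi hj.
have n_gt0 : (0 < n)%N by exact: leq_ltn_trans i_lt.
have above : exists t, (y <= h ((i + t) %% n)%N)%O.
  exists (j + n - i)%N; rewrite subnKC; first by rewrite modnDr modn_small.
  by rewrite (leq_trans (ltnW i_lt))// leq_addl.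
case: (ex_minnP above) => -[|t] yt tmin.
  by move: yt; rewrite addn0 modn_small// leNgt hi.
exists ((i + t) %% n)%N; first by rewrite ltn_mod.
rewrite -addn1 modnDml addn1 -addnS yt andbT ltNge.
by apply/negP => /tmin; rewrite ltnn.
Qed.

End cyclic_sequences.

Section dot_product.
Variable R : realType.

Definition dotp (u p : R * R) : R := u.1 * p.1 + u.2 * p.2.

Fact dotp_is_scalar u : scalar (dotp u).
Proof. by move=> a p q; rewrite /dotp/= /GRing.scale/=; ring. Qed.

HB.instance Definition _ u :=
  GRing.isLinear.Build R (R * R)%type R *%R (dotp u) (dotp_is_scalar u).

Lemma continuous_dotp u : continuous (dotp u).
Proof.
by move=> p; apply: cvgD; apply: cvgMr; [exact: cvg_fst|exact: cvg_snd].
Qed.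

End dot_product.

Section polygon_convexity.
Variables (R : realType) (n : nat) (v : nat -> R * R).

Lemma polygonE : polygon n v =
  [set \sum_(i < n) w i *: v i |
    w in [set w : nat -> R | (forall i, 0 <= w i) /\ \sum_(i < n) w i = 1]].
Proof.
have sumE (w : nat -> R) : \sum_(i < n) w i *: v i =
    (\sum_(i < n) w i * (v i).1, \sum_(i < n) w i * (v i).2).
  by apply: (big_ind3 (fun p x y => p = (x, y))) => // _ x1 y1 _ x2 y2 -> ->.
apply/seteqP; split => [_ [w [w0 [w1 ->]]]|_ [w [w0 w1] <-]].
  by exists w; rewrite ?sumE.
by exists w; rewrite sumE.
Qed.

Lemma polygon_vertex i : (i < n)%N -> polygon n v (v i).
Proof.
move=> i_lt; have sum_pick (V : lmodType R) (f : nat -> V) :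
    \sum_(j < n) (val j == i)%:R *: f j = f i.
  rewrite (bigD1 (Ordinal i_lt))//= eqxx scale1r big1 ?addr0// => j.
  by rewrite -val_eqE/= => /negPf ->; rewrite scale0r.
rewrite polygonE; exists (fun j => (j == i)%:R) => /=; last exact: sum_pick.
split=> [j|]; first exact: ler0n.
rewrite -[RHS](sum_pick R^o (fun=> 1)).
by apply: eq_bigr => j _; rewrite [RHS]mulr1.
Qed.

Lemma convex_polygon : convex_set (polygon n v).
Proof.
rewrite polygonE => p q t /set_mem[w [w0 w1] <-] /set_mem[w' [w'0 w'1] <-].
have t0 : 0 <= t%:num by []; have t1 : t%:num <= 1 by [].
apply/mem_set; exists (fun i => t%:num * w i + (1 - t%:num) * w' i) => /=.
  split=> [i|]; first by rewrite addr_ge0// mulr_ge0// subr_ge0.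
  by rewrite big_split/= -!mulr_sumr w1 w'1 !mulr1 subrKC.
rewrite /conv/= !scaler_sumr -big_split; apply: eq_bigr => i _.
by rewrite scalerDl -!scalerA.
Qed.

Definition simplex : set 'rV[R]_n :=
  [set w | (forall i, 0 <= w ord0 i) /\ \sum_i w ord0 i = 1].

Lemma polygon_simplexE :
  polygon n v = (fun w : 'rV[R]_n => \sum_i w ord0 i *: v i) @` simplex.
Proof.
rewrite polygonE; apply/seteqP; split => [_ [w [w0 w1] <-]|_ [w [w0 w1] <-]].
  exists (\row_i w i); last by apply: eq_bigr => i _; rewrite mxE.
  by split=> [i|]; [rewrite mxE|under eq_bigr do rewrite mxE].
exists (fun i => if insub i is Some j then w ord0 j else 0); last first.
  by apply: eq_bigr => i _; rewrite valK.
by split=> [i|]; [case: insub|under eq_bigr do rewrite valK].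
Qed.

Lemma compact_simplex : compact simplex.
Proof.
have -> : simplex = [set w : 'rV[R]_n | forall i, `[0, 1]%classic (w ord0 i)]
    `&` (fun w : 'rV[R]_n => \sum_i w ord0 i) @^-1` [set 1].
  apply/seteqP; split => [w [w0 w1]|w [w01 w1]]; split=> // i.
    rewrite /= in_itv/= w0/= -w1 (bigD1 i)//= lerDl; exact: sumr_ge0.
  by have := w01 i; rewrite /= in_itv/= => /andP[].
apply: compact_closedI.
  exact: (@rV_compact R n (fun=> `[0, 1]%classic)
    (fun=> @segment_compact R 0 1)).
apply: preimage_closed; last exact: closed_eq.
move=> w _; apply: continuous_big => [|i _]; first exact: add_continuous.
exact: coord_continuous.
Qed.

Lemma compact_polygon : compact (polygon n v).
Proof.
rewrite polygon_simplexE.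
apply: continuous_compact; last exact: compact_simplex.
apply: continuous_subspaceT; apply: continuous_big => [|i _ w].
  exact: add_continuous.
exact: continuous_comp (@coord_continuous R 1 n ord0 i w)
  (@scalel_continuous _ _ (v i) _).
Qed.

Lemma closed_polygon : closed (polygon n v).
Proof. by apply: compact_closed compact_polygon; exact: norm_hausdorff. Qed.

End polygon_convexity.

Lemma weighted_mean_itv (R : numDomainType) (I : finType) (w x : I -> R)
    (a b : R) :
  (forall i, 0 <= w i) -> \sum_i w i = 1 -> (forall i, a <= x i <= b) ->
  a <= \sum_i w i * x i <= b.
Proof.
move=> w0 w1 xab; rewrite -[a]mul1r -[b]mul1r -w1 !mulr_suml.
by apply/andP; split; apply: ler_sum => i _; rewrite ler_wpM2l//;
  case/andP: (xab i).
Qed.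

Section polygon_projection.
Variables (R : realType) (n : nat) (v : nat -> R * R) (u : R * R).
Local Notation mu := (@lebesgue_measure R).
Local Notation next i := (i.+1 %% n)%N.
Local Notation h i := (dotp u (v i)).

Lemma dotp_polygon_subset (i0 : 'I_n) : (forall i : 'I_n, h i0 <= h i) ->
  dotp u @` polygon n v `<=`
    h i0 |` \bigcup_(k < n) `]h k, h (next k)]%classic.
Proof.
rewrite polygonE => i0min _ [_ [w [w0 w1] <-] <-].
have [j _ jmax] := Order.TotalTheory.arg_maxP (fun i : 'I_n => h i)
  (erefl : xpredT i0).
have /andP[] : h i0 <= dotp u (\sum_(i < n) w i *: v i) <= h j.
  rewrite linear_sum (eq_bigr (fun i : 'I_n => w i * h i)).
    by apply: weighted_mean_itv => // i; rewrite i0min; exact: jmax.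
  by move=> i _; rewrite linearZ.
rewrite le_eqVlt => /predU1P[<- _|i0y yj]; [by left|right].
have [k k_lt hk] :=
  cyclic_upcrossing (h := fun i => h i) (ltn_ord i0) (ltn_ord j) i0y yj.
by exists k => //=; rewrite in_itv.
Qed.

Lemma dotp_polygon_supset (i0 : 'I_n) :
  h i0 |` \bigcup_(k < n) `]h k, h (next k)]%classic `<=`
    dotp u @` polygon n v.
Proof.
have vertex i : (i < n)%N -> (dotp u @` polygon n v) (h i).
  by move=> i_lt; exists (v i) => //; exact: polygon_vertex.
have n_gt0 : (0 < n)%N by exact: leq_ltn_trans (ltn_ord i0).
move=> y [->|[k /= k_lt]]; first exact: vertex.
rewrite in_itv/= => /andP[ky yk].
have T_itv := is_interval_linear_image (f := dotp u) (@convex_polygon R n v).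
apply: (T_itv _ _ (vertex k _) (vertex (next k) _)); rewrite ?ltn_mod//.
by rewrite ltW.
Qed.

Hypothesis cvx : convex_polygon_vertices n v.

Let n_gt0 : (0 < n)%N. Proof. by case: cvx => + _; exact: leq_trans. Qed.

(* The point where edge l crosses the height y upwards lies strictly to the
   left of edge k.  Exchanging k and l reverses the offset between the two
   crossing points, so both cannot be positive. *)
Lemma cross3_edge_gt0 (k l : 'I_n) (y : R) : k != l ->
  h k < y <= h (next k) -> h l < y <= h (next l) ->
  0 < (h (next l) - y) * cross3 (v k) (v (next k)) (v l) +
      (y - h l) * cross3 (v k) (v (next k)) (v (next l)).
Proof.
move=> kl /andP[ky yk] /andP[ly yl]; have [_ left_of_edge] := cvx.
have lk : l <> k :> nat by move=> /val_inj lk; rewrite lk eqxx in kl.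
have next_l : 0 < cross3 (v k) (v (next k)) (v (next l)).
  apply: left_of_edge; rewrite ?ltn_mod//.
    by move=> nlk; move: yl; rewrite nlk leNgt ky.
  by move=> nlk; apply: lk; congr val; apply: ordS_inj; exact: val_inj.
have l_ge0 : 0 <= cross3 (v k) (v (next k)) (v l).
  have [->|/eqP lnk] := eqVneq (l : nat) (next k).
    by rewrite le_eqVlt; apply/orP; left; apply/eqP; rewrite /cross3; ring.
  by apply: ltW; exact: left_of_edge.
have yl_ge0 : 0 <= h (next l) - y by rewrite subr_ge0.
have ly_gt0 : 0 < y - h l by rewrite subr_gt0.
by apply: ltr_wpDl; [exact: mulr_ge0|exact: mulr_gt0].
Qed.

Lemma upcrossing_unique (k l : 'I_n) (y : R) :
  h k < y <= h (next k) -> h l < y <= h (next l) -> k = l.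
Proof.
move=> hk hl; apply/eqP/negPn/negP => kl.
have kl_gt0 := cross3_edge_gt0 kl hk hl.
have := cross3_edge_gt0 _ hl hk; rewrite eq_sym => /(_ kl) lk_gt0.
set A := (X in 0 < X) in kl_gt0; set B := (X in 0 < X) in lk_gt0.
have AB_neq0 : A + B != 0 by rewrite gt_eqF// addr_gt0.
have u1 : u.1 * (A + B) = 0 by rewrite /A /B /cross3 /dotp; ring.
have u2 : u.2 * (A + B) = 0 by rewrite /A /B /cross3 /dotp; ring.
move: u1 u2 => /eqP + /eqP; rewrite !mulf_eq0 !(negPf AB_neq0) !orbF.
move=> /eqP u1 /eqP u2; case/andP: hk; rewrite /dotp u1 u2 !mul0r addr0.
by move=> /lt_le_trans/[apply]; rewrite ltxx.
Qed.

Lemma lebesgue_measure_dotp_polygon : mu (dotp u @` polygon n v) =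
  (2^-1 * \sum_(k < n) `|h (next k) - h k|)%:E.
Proof.
have [i0 _ i0min] := Order.TotalTheory.arg_minP
  (fun i : 'I_n => h i) (erefl : xpredT (Ordinal n_gt0)).
have -> : dotp u @` polygon n v =
    h i0 |` \big[setU/set0]_(k < n) `]h k, h (next k)]%classic.
  rewrite -(bigcup_mkord n (fun k => `]h k, h (next k)]%classic)).
  apply/seteqP; split; last exact: dotp_polygon_supset.
  by apply: dotp_polygon_subset => i; exact: i0min.
set U := \big[_/_]_(_ < n) _.
have mU : measurable U.
  by apply: bigsetU_measurable => k _; exact: measurable_itv.
have -> : mu (h i0 |` U) = mu U.
  by rewrite setUC measureU0//; exact: lebesgue_measure_set1.
rewrite measure_bigsetU_ord//; last first.
  apply/trivIsetP => k l _ _ kl; rewrite -subset0 => y []/=.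
  rewrite !in_itv/= => yk yl; move/eqP: kl; apply; exact: upcrossing_unique yl.
have half_sum (k : 'I_n) : mu `]h k, h (next k)]%classic =
    (2^-1 * (`|h (next k) - h k| + (h (next k) - h k)))%:E.
  rewrite [LHS]lebesgue_measure_itv/= lte_fin.
  case: ltP => kn; rewrite -?EFinB; congr EFin.
    by rewrite ger0_norm ?subr_ge0 1?ltW//; field.
  by rewrite ler0_norm ?subr_le0//; ring.
rewrite (eq_bigr _ (fun k _ => half_sum k)) sumEFin -mulr_sumr big_split/=.
by rewrite sumrB (sum_cyclic_next n (fun k => h k)) subrr addr0.
Qed.

End polygon_projection.

Definition has_countable_base (T : topologicalType) (M : set_system T) :=
  exists (I : countType) (B : I -> set T), (forall i, M (B i)) /\
    forall x U, nbhs x U -> exists2 i, B i x & B i `<=` U.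

Lemma has_countable_baseX (T1 T2 : topologicalType) (M1 : set_system T1)
    (M2 : set_system T2) (M : set_system (T1 * T2)) :
  (forall A B, M1 A -> M2 B -> M (A `*` B)) ->
  has_countable_base M1 -> has_countable_base M2 -> has_countable_base M.
Proof.
move=> MX [I1 [B1 [MB1 baseB1]]] [I2 [B2 [MB2 baseB2]]].
exists (I1 * I2)%type, (fun i => B1 i.1 `*` B2 i.2).
split=> [i|]; first exact: MX.
move=> [x y] U [[/= U1 U2] [/baseB1[i B1x B1U1] /baseB2[j B2y B2U2]] U12].
by exists (i, j) => //= -[x' y'] [/B1U1 ? /B2U2 ?]; exact: U12.
Qed.

Lemma has_countable_base_closed (T : topologicalType) (M : set_system T) A :
  sigma_algebra setT M -> has_countable_base M -> closed A -> M A.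
Proof.
move=> [M0 MC Mcup] [I [B [MB baseB]]] cA.
pose U i := if `[< B i `<=` ~` A >] then B i else set0.
have -> : A = setT `\` \bigcup_k oapp U set0 (unpickle k).
  rewrite setTD -[LHS]setCK; congr (~` _).
  apply/seteqP; split => [x Ax|x [k _]].
    have [i Bx BA] := baseB x _ (open_nbhs_nbhs (conj (closed_openC cA) Ax)).
    by exists (pickle i); rewrite // pickleK /U /= ifT//; exact/asboolP.
  by case: unpickle => //= i; rewrite /U; case: ifPn => // /asboolP; exact.
apply: MC; apply: Mcup => k; case: unpickle => //= i.
by rewrite /U; case: ifP.
Qed.

Section plane_measurability.
Variable R : realType.

Lemma has_countable_base_line :
  has_countable_base (@measurable _ (measurableTypeR R)).
Proof.
exists (rat * rat)%type, (fun q => `]ratr q.1, ratr q.2[%classic); split.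
  by move=> q; exact: measurable_itv.
move=> x U /nbhs_ballP[e /= e_gt0 eU].
have [p /[!in_itv]/= /andP[ep px]] :
  exists q, ratr q \in `]x - e, x[%R by apply: rat_in_itvoo; lra.
have [q /[!in_itv]/= /andP[xq qe]] :
  exists q, ratr q \in `]x, x + e[%R by apply: rat_in_itvoo; lra.
exists (p, q) => /=; first by rewrite in_itv/= px.
move=> y /=; rewrite in_itv/= => /andP[py yq]; apply: eU.
by rewrite /ball/= ltr_norml; lra.
Qed.

Lemma has_countable_base_plane :
  has_countable_base
    (@measurable _ (measurableTypeR R * measurableTypeR R)%type).
Proof.
by apply: has_countable_baseX has_countable_base_line has_countable_base_line;
  exact: measurableX.
Qed.

Lemma closed_measurable_plane (A : set (R * R)) : closed A -> measurable A.
Proof.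
apply: has_countable_base_closed has_countable_base_plane.
exact: sigma_algebra_measurable.
Qed.

Lemma closed_measurable_space (A : set ((R * R) * R)) :
  closed A -> measurable A.
Proof.
apply: has_countable_base_closed; first exact: sigma_algebra_measurable.
by apply: has_countable_baseX has_countable_base_plane has_countable_base_line;
  exact: measurableX.
Qed.

End plane_measurability.

Lemma closed_compact_proj (X Y : topologicalType) (K : set X)
    (C : set (X * Y)) :
  compact K -> closed C -> closed [set y | exists2 x, K x & C (x, y)].
Proof.
move=> cK cC; rewrite -[X in closed X]setCK; apply: open_closedC.
rewrite openE => y yN.
have /(_ (fun y x => ~ C (x, y))) near_cover :=
  (compact_near_coveringP K).1 cK _ (nbhs y).
apply: filterS (near_cover _ _) => [z zN [x /zN]//|x Kx].
have : nbhs (x, y) (~` C).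
  apply: open_nbhs_nbhs; split; first exact: closed_openC.
  by move=> Cxy; apply: yN; exists x.
by apply: filterS => -[].
Qed.

Section detection.
Variable R : realType.
Implicit Types (Omega T : set (R * R)) (p : R * R) (r rmax th : R).

Definition dir th : R * R := (cos th, sin th).

Definition ray_point (tz : R * ((R * R) * R)) : R * R :=
  tz.2.1 + tz.1 *: dir tz.2.2.

Lemma continuous_ray_point : continuous ray_point.
Proof.
have c_dir : continuous dir.
  by move=> th; exact: cvg_pair (@continuous_cos R th) (@continuous_sin R th).
move=> z; apply: cvgD.
  by apply: continuous_comp; [exact: cvg_snd|exact: cvg_fst].
apply: cvgZ; first exact: cvg_fst.
apply: (@continuous_comp _ _ _ (fun tz : R * ((R * R) * R) => tz.2.2) dir).
  by apply: continuous_comp; [exact: cvg_snd|exact: cvg_snd].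
exact: c_dir.
Qed.

Lemma hit_setE T r p th :
  hit_set T r p th = `[0, r] `&` (fun t => ray_point (t, (p, th))) @^-1` T.
Proof. by apply/seteqP; split => t; rewrite /hit_set /= in_itv. Qed.

Definition detection_region T r th : set (R * R) :=
  [set p | hit_set T r p th !=set0].

Definition detection_set T r : set ((R * R) * R) :=
  [set z | detection_region T r z.2 z.1].

Lemma ysection_detection_set T r th :
  ysection (detection_set T r) th = detection_region T r th.
Proof. by apply/seteqP; split => p; rewrite /ysection /= inE. Qed.

Lemma closed_detection_set T r : closed T -> closed (detection_set T r).
Proof.
move=> cT; rewrite (_ : detection_set T r =
    [set z | exists2 t, `[0, r]%classic t & (ray_point @^-1` T) (t, z)]).
  apply: closed_compact_proj; first exact: segment_compact.
  by apply: preimage_closed => // tz _; exact: continuous_ray_point.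
apply/seteqP; split => -[p th] [t].
  by rewrite hit_setE => -[t0r Tt]; exists t.
by move=> t0r Tt; exists t; rewrite hit_setE.
Qed.

Lemma compact_hit_set T r p th : closed T -> compact (hit_set T r p th).
Proof.
move=> cT; rewrite hit_setE.
apply: compact_closedI; first exact: segment_compact.
apply: preimage_closed => // t _.
apply: continuous_comp; last exact: continuous_ray_point.
exact: cvg_pair cvg_id (cvg_cst (p, th)).
Qed.

Lemma detect_leP T rmax r p th : closed T -> r <= rmax ->
  detect_le T rmax r p th <-> detection_region T r th p.
Proof.
move=> cT r_rmax; split.
  by move=> [s [[/andP[s0 _] Ts] [_ sr]]]; exists s; split=> //; rewrite s0.
move=> [t [/andP[t0 tr] Tt]].
have hit_t : hit_set T rmax p th t by split=> //; rewrite t0 (le_trans tr).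
have [s /set_mem hit_s s_min] := compact_EVT_min (ex_intro _ _ hit_t)
  (compact_hit_set cT) (continuous_subspaceT (fun x : R => cvg_id)).
exists s; split=> //; split=> [u hit_u|]; first by apply: s_min; exact: mem_set.
by rewrite (le_trans _ tr)// s_min//; exact: mem_set.
Qed.

Lemma detection_region_dist2 T r p th : detection_region T r th p ->
  exists q, T q /\ dist2 p q <= r.
Proof.
move=> [t [/andP[t0 tr] Tt]]; eexists; split; first exact: Tt.
rewrite /dist2 /= (_ : _ ^+ 2 + _ = t ^+ 2).
  by rewrite sqrtr_sqr ger0_norm.
by rewrite -[RHS]mulr1 -(cos2Dsin2 th); ring.
Qed.

Lemma detection_eventE Omega T rmax r : closed T -> r <= rmax ->
  (forall p, (exists q, T q /\ dist2 p q <= rmax) -> Omega p) ->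
  [set z | Omega z.1 /\ 0 <= z.2 < 2 * pi /\ detect_le T rmax r z.1 z.2] =
  detection_set T r `&` snd @^-1` `[0, 2 * pi[.
Proof.
move=> cT r_rmax near_Omega.
apply/seteqP; split => -[p th] /=; rewrite in_itv/=.
  by move=> [_ [th_itv /(detect_leP _ _ cT r_rmax)]].
move=> [hit th_itv]; split; last by split=> //; apply/detect_leP.
have [q [Tq pq]] := detection_region_dist2 hit.
by apply: near_Omega; exists q; split=> //; exact: le_trans r_rmax.
Qed.

End detection.

Section product_measures.
Local Open Scope ereal_scope.
Context d1 d2 (T1 : measurableType d1) (T2 : measurableType d2) (R : realType).
Variables (m1 : {sigma_finite_measure set T1 -> \bar R})
  (m2 : {sigma_finite_measure set T2 -> \bar R}).

Lemma product_measure12E A : measurable A -> (m1 \x m2) A = (m1 \x^ m2) A.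
Proof.
move=> mA; apply: product_measure_unique => // B C mB mC.
exact: product_measure2E.
Qed.

End product_measures.

Section lebesgue_line.
Variable R : realType.
Local Notation mu := (@lebesgue_measure R).

Lemma lebesgue_measure_shift (A : set R) (a : R) : measurable A ->
  mu [set x | A (x + a)] = mu A.
Proof.
move=> mA.
have m_shift : measurable_fun [set: measurableTypeR R]
  (fun x : R => x + a : measurableTypeR R) by exact: measurable_funD.
pose shift_mu : {measure set (measurableTypeR R) -> \bar R} :=
  pushforward mu (fun x : R => x + a : measurableTypeR R).
apply/esym/(lebesgue_measure_unique (mu := shift_mu m_shift)) => //.
move=> _ /ocitvP[->|[[b c] /= bc ->]]; first by rewrite !measure0.
rewrite [RHS](_ : _ = mu `]b - a, c - a]%classic).
  rewrite !lebesgue_measure_itv/= !lte_fin ltrD2r; case: ifPn => // _.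
  by rewrite -!EFinB; congr EFin; ring.
congr (mu _); apply/seteqP; split => x /=; rewrite !in_itv/=; lra.
Qed.

Lemma compact_is_interval_segment (S : set R) : S !=set0 -> compact S ->
  is_interval S -> exists a b, a <= b /\ S = `[a, b]%classic.
Proof.
move=> S0 cS iS; have cid := continuous_subspaceT (fun x : R => cvg_id).
have [a /set_mem Sa a_min] := compact_EVT_min S0 cS (cid S).
have [b /set_mem Sb b_max] := compact_EVT_max S0 cS (cid S).
exists a, b; split; first by apply: a_min; exact: mem_set.
apply/seteqP; split => x; rewrite /= in_itv/=; last exact: iS.
by move=> /mem_set Sx; rewrite a_min// b_max.
Qed.

Definition stretch (S : set R) (r c : R) : set R :=
  [set x | exists2 t, 0 <= t <= r & S (x + t * c)].

Lemma stretch_segment (a b r c : R) : 0 <= r -> 0 <= c -> a <= b ->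
  stretch `[a, b] r c = `[a - r * c, b]%classic.
Proof.
move=> r0 c0 ab; apply/seteqP; split => [x [t /andP[t0 tr]]|x] /=;
    rewrite !in_itv/=.
  by have := ler_wpM2r c0 t0; have := ler_wpM2r c0 tr; lra.
move=> /andP[ax xb]; have [ax0|xa] := leP a x.
  by exists 0; rewrite ?lexx//= in_itv/= mul0r addr0 ax0.
have {}c0 : 0 < c by rewrite lt_neqAle c0 andbT; apply/eqP => cE; move: ax;
  rewrite -cE mulr0; lra.
exists ((a - x) / c); first by rewrite divr_ge0 ?ler_pdivrMr//; lra.
by rewrite /= in_itv/= divfK ?gt_eqF//; lra.
Qed.

Lemma stretchN (S : set R) (r c : R) :
  stretch S r c = [set x | stretch S r (- c) (x + r * c)].
Proof.
apply/seteqP; split => x [t /andP[t0 tr] St]; exists (r - t); try lra.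
  by move: St; congr S; ring.
by move: St; congr S; ring.
Qed.

Lemma lebesgue_measure_stretch (S : set R) (r c : R) : 0 <= r ->
  S !=set0 -> compact S -> is_interval S ->
  (mu (stretch S r c) = mu S + (r * `|c|)%:E)%E.
Proof.
move=> r0 S0 cS /(compact_is_interval_segment S0 cS)[a [b [ab ->]]].
wlog c0 : c / 0 <= c => [hwlog|].
  have [/hwlog//|c_lt0] := leP 0 c.
  have Nc0 : 0 <= - c by rewrite oppr_ge0 ltW.
  rewrite stretchN lebesgue_measure_shift; first by rewrite hwlog// normrN.
  by rewrite stretch_segment//; exact: measurable_itv.
have segmentE (x y : R) : x <= y -> mu `[x, y]%classic = (y - x)%:E.
  rewrite [mu _]lebesgue_measure_itv/= lte_fin le_eqVlt => /predU1P[->|->//].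
  by rewrite ltxx subrr.
have rc0 := mulr_ge0 r0 c0.
rewrite stretch_segment// !segmentE//; last lra.
by rewrite ger0_norm// -EFinD; congr EFin; ring.
Qed.

End lebesgue_line.

Section area.
Variable R : realType.
Local Notation mu := (@lebesgue_measure R).
Implicit Types (A : set (R * R)) (m y : R).

Lemma area_ysection A : measurable A ->
  area A = (\int[mu]_y mu (ysection A y))%E.
Proof. exact: (@product_measure12E _ _ _ _ R mu mu). Qed.

(* [area] under a name of its own: on the product itself, inference finds only
   the sigma-finite instance of products of subprobabilities. *)
Definition plane_measure :
    set (measurableTypeR R * measurableTypeR R)%type -> \bar R :=
  (mu \x mu)%E.

HB.instance Definition _ := Measure.on plane_measure.

Fact sigma_finite_plane_measure : sigma_finite setT plane_measure.
Proof.
pose I n : set R := `[- n%:R, n%:R]%classic.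
have mI n : measurable (I n) by exact: measurable_itv.
exists (fun n => I n `*` I n) => [|n].
  apply/esym/seteqP; split => // -[x y] _.
  have := archi_boundP (addr_ge0 (normr_ge0 x) (normr_ge0 y)).
  set n := Num.bound _ => xy; exists n => //.
  by have := normr_ge0 x; have := normr_ge0 y;
    split; rewrite /I /= in_itv/= -ler_norml; lra.
split; first exact: measurableX (mI n) (mI n).
have I_lty : (mu (I n) < +oo)%E.
  by apply: compact_finite_measure; exact: segment_compact.
rewrite [ltLHS](product_measure1E mu mu (mI n) (mI n)).
by rewrite lte_mul_pinfty// ge0_fin_numE.
Qed.

HB.instance Definition _ := Measure_isSigmaFinite.Build _ _ _ plane_measure
  sigma_finite_plane_measure.

Lemma vol3_ysection (A : set ((R * R) * R)) : measurable A ->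
  vol3 A = (\int[mu]_z area (ysection A z))%E.
Proof. exact: (@product_measure12E _ _ _ _ R plane_measure mu). Qed.

Definition shear m (p : R * R) : R * R := (p.1, p.2 + m * p.1).

Lemma measurable_shear A m : measurable A -> measurable (shear m @^-1` A).
Proof.
move=> mA; rewrite -[X in measurable X]setTI.
have m_shear : measurable_fun setT (shear m); last exact: m_shear.
apply: measurable_fun_pair => //; apply: measurable_funD => //.
exact: measurable_funM.
Qed.

Lemma area_shear A m : measurable A -> area (shear m @^-1` A) = area A.
Proof.
move=> mA; apply: eq_integral => x _ /=.
rewrite -[RHS](lebesgue_measure_shift (m * x)); last exact: measurable_xsection.
by congr (mu _); apply/seteqP; split => y; rewrite /xsection /= !inE.
Qed.

Definition oblique_slice m A y : set R := [set x | A (x, y + m * x)].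

Lemma ysection_shear m A y :
  ysection (shear m @^-1` A) y = oblique_slice m A y.
Proof. by apply/seteqP; split => x; rewrite /ysection /= inE. Qed.

Lemma measurable_fun_oblique_slice m A : measurable A ->
  measurable_fun setT (fun y => mu (oblique_slice m A y)).
Proof.
move=> /(measurable_shear m)/(measurable_fun_ysection mu).
by apply: eq_measurable_fun => y _ /=; rewrite ysection_shear.
Qed.

Lemma area_oblique_slice m A : measurable A ->
  area A = (\int[mu]_y mu (oblique_slice m A y))%E.
Proof.
move=> mA; rewrite -(area_shear m mA).
rewrite area_ysection; last exact: measurable_shear.
by apply: eq_integral => y _; rewrite ysection_shear.
Qed.

End area.

Section trigonometric_integral.
Variable R : realType.
Local Notation mu := (@lebesgue_measure R).
Implicit Types a b c t u w z : R.

Lemma integral_is_derive (f F : R -> R) u w : u <= w -> continuous f ->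
  (forall t, is_derive t 1 F (f t)) ->
  (\int[mu]_(t in `[u, w[) (f t)%:E = (F w - F u)%:E)%E.
Proof.
rewrite le_eqVlt => /predU1P[-> _ _|uw cf dF].
  by rewrite subrr set_itvco0 integral_set0.
have cF : continuous F.
  by move=> t; apply: differentiable_continuous; apply/derivable1_diffP.
rewrite integral_itv_bndo_bndc.
  rewrite (continuous_FTC2 (F := F)) ?EFinB//.
  - exact: continuous_subspaceT.
  - split=> [t _||]; first by [].
      exact/cvg_at_right_filter/cF.
    exact/cvg_at_left_filter/cF.
  - by move=> t _; rewrite derive1E; exact: derive_val.
apply/measurable_EFinP; apply: measurable_funTS.
exact: continuous_measurable_fun.
Qed.

Lemma continuous_sinB z : continuous (fun t => sin (t - z)).
Proof.
move=> t; apply: continuous_comp; last exact: continuous_sin.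
by apply: cvgB; [exact: cvg_id|exact: cvg_cst].
Qed.

Lemma integral_normr_sin c z u w : u <= w ->
  (forall t, u <= t <= w -> `|sin (t - z)| = c * sin (t - z)) ->
  (\int[mu]_(t in `[u, w[) (`|sin (t - z)|)%:E =
    (c * (cos (u - z) - cos (w - z)))%:E)%E.
Proof.
move=> uw sinE.
transitivity (\int[mu]_(t in `[u, w[) (c * sin (t - z))%:E)%E.
  apply: eq_integral => t; rewrite inE/= in_itv/= => /andP[ut tw].
  by rewrite sinE// ut ltW.
have dcos t : is_derive t 1 (fun t => - c * cos (t - z)) (c * sin (t - z)).
  by apply: is_derive_eq; rewrite /GRing.scale/=; ring.
rewrite (integral_is_derive uw _ dcos); first by congr EFin; ring.
by move=> t; apply: cvgMr; exact: continuous_sinB.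
Qed.

Lemma measurable_normr_continuous (f : R -> R) (D : set R) : continuous f ->
  measurable_fun D (fun t => (`|f t|)%:E).
Proof.
move=> cf; apply/measurable_EFinP/measurable_funTS/measurableT_comp => //.
exact: continuous_measurable_fun.
Qed.

Lemma ge0_integral_itvco_split (f : R -> \bar R) u t w : u <= t -> t <= w ->
  measurable_fun setT f -> (forall x, 0 <= f x)%E ->
  (\int[mu]_(x in `[u, w[) f x =
    \int[mu]_(x in `[u, t[) f x + \int[mu]_(x in `[t, w[) f x)%E.
Proof.
move=> ut tw mf f0; rewrite (@itv_bndbnd_setU _ _ _ (BLeft t)) ?bnd_simp//.
rewrite ge0_integral_setU//=; first exact: measurable_funTS.
by apply/disj_setPS => x; rewrite /= !in_itv/=; lra.
Qed.

Lemma integral_normr_sin_period z : 0 <= z <= pi ->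
  (\int[mu]_(t in `[0%R, (2 * pi)%R[) (`|sin (t - z)|)%:E = 4%:E)%E.
Proof.
move=> /andP[z0 zpi]; have pi0 := pi_gt0 R.
have m_sin D := measurable_normr_continuous (D := D) (@continuous_sinB z).
have sin_neg t : - pi <= t <= 0 -> `|sin t| = -1 * sin t.
  move=> tpi; rewrite ler0_norm ?mulN1r// -oppr_ge0 -sinN.
  by apply: sin_ge0_pi; lra.
rewrite (@ge0_integral_itvco_split _ 0 z)//; last lra.
rewrite (@ge0_integral_itvco_split _ z (z + pi))//; [|lra..].
rewrite (integral_normr_sin (c := -1))//; last first.
  by move=> t ?; apply: sin_neg; lra.
rewrite (integral_normr_sin (c := 1)); [|lra|]; last first.
  by move=> t ?; rewrite mul1r ger0_norm//; apply: sin_ge0_pi; lra.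
rewrite (integral_normr_sin (c := -1)); [|lra|]; last first.
  move=> t ?; rewrite -[t - z](subrK pi) sinDpi normrN mulN1r opprK ger0_norm//.
  by apply: sin_ge0_pi; lra.
rewrite -!EFinD; congr EFin.
rewrite subrr cos0 [z + pi - z]addrC addKr cospi.
rewrite mulr_natl -[pi *+ 2 - z]addrC cosD2pi sub0r; ring.
Qed.

Lemma continuous_trig a b : continuous (fun t => a * cos t + b * sin t).
Proof.
move=> t; apply: cvgD; apply: cvgMr; first exact: continuous_cos.
exact: continuous_sin.
Qed.

Lemma normr_trig_phase a b : exists2 z, 0 <= z <= pi & forall t,
  `|a * cos t + b * sin t| = Num.sqrt (a ^+ 2 + b ^+ 2) * `|sin (t - z)|.
Proof.
have pi0 := pi_ge0 R.
have [z /[!in_itv]/= zpi z_zero] :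
    exists2 z, z \in `[0, pi] & a * cos z + b * sin z = 0.
  apply: IVT => //; first exact/continuous_subspaceT/continuous_trig.
  rewrite cos0 sin0 cospi sinpi !mulr0 !addr0 mulr1 mulrN1.
  by case: (lerP a (- a)) => ?; lra.
exists z => // t; pose g := b * cos z - a * sin z.
have -> : a ^+ 2 + b ^+ 2 = g ^+ 2.
  rewrite -[LHS]mulr1 -(cos2Dsin2 z).
  transitivity (g ^+ 2 + (a * cos z + b * sin z) ^+ 2).
    by rewrite /g; ring.
  by rewrite z_zero expr0n addr0.
rewrite sqrtr_sqr -normrM; congr `|_|.
rewrite -[in LHS](subrK z t) (cosD (t - z)) (sinD (t - z) z).
transitivity (cos (t - z) * (a * cos z + b * sin z) + g * sin (t - z)).
  by rewrite /g; ring.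
by rewrite z_zero mulr0 add0r.
Qed.

Lemma integral_normr_trig a b :
  (\int[mu]_(t in `[0%R, (2 * pi)%R[) (`|a * cos t + b * sin t|)%:E =
    (4 * Num.sqrt (a ^+ 2 + b ^+ 2))%:E)%E.
Proof.
have [z zpi normE] := normr_trig_phase a b.
under eq_integral do rewrite normE EFinM.
rewrite ge0_integralZl//; last first.
  exact: measurable_normr_continuous (@continuous_sinB z).
by rewrite integral_normr_sin_period// -EFinM mulrC.
Qed.

End trigonometric_integral.

Section detection_area.
Variables (R : realType) (T : set (R * R)) (r : R).
Local Notation mu := (@lebesgue_measure R).
Hypotheses (cT : compact T) (convT : convex_set T) (r_ge0 : 0 <= r).

Let closedT : closed T.
Proof. by apply: compact_closed => //; exact: norm_hausdorff. Qed.

Lemma measurable_detection_set : measurable (detection_set T r).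
Proof. by apply: closed_measurable_space; exact: closed_detection_set. Qed.

Lemma oblique_sliceE m y :
  oblique_slice m T y = fst @` (T `&` dotp (- m, 1) @^-1` [set y]).
Proof.
apply/seteqP; split => [x Tx|_ [[x z] /= [Txz <-] <-]].
  by exists (x, y + m * x) => //; split=> //=; rewrite /dotp/=; ring.
by move: Txz; congr T; congr pair; rewrite /dotp/=; ring.
Qed.

Lemma oblique_slice_neq0 m y :
  oblique_slice m T y !=set0 <-> (dotp (- m, 1) @` T) y.
Proof.
rewrite oblique_sliceE; split=> [[_ [p [Tp py] _]]|[p Tp py]].
  by exists p.
by exists p.1, p.
Qed.

Lemma compact_oblique_slice m y : compact (oblique_slice m T y).
Proof.
rewrite oblique_sliceE; apply: continuous_compact.
  by apply: continuous_subspaceT => p; exact: cvg_fst.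
apply: compact_closedI => //; apply: preimage_closed; last exact: closed_eq.
by move=> p _; exact: continuous_dotp.
Qed.

Lemma is_interval_oblique_slice m y : is_interval (oblique_slice m T y).
Proof.
have -> : oblique_slice m T y = [set x : R | T ((0, y) + x *: (1, m))].
  by apply/seteqP; split => x; congr T; congr pair => /=;
    rewrite /GRing.scale/=; ring.
exact: is_interval_line_section.
Qed.

Lemma oblique_slice_detection_region th y : cos th != 0 ->
  oblique_slice (tan th) (detection_region T r th) y =
  stretch (oblique_slice (tan th) T y) r (cos th).
Proof.
move=> cos0; have sinE : sin th = tan th * cos th by rewrite /tan divfK.
have hitE x t : T (x + t * cos th, y + tan th * x + t * sin th) =
    T (x + t * cos th, y + tan th * (x + t * cos th)).
  by rewrite sinE; congr T; congr pair; ring.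
by apply/seteqP; split => x [t];
  [move=> [t0r]; rewrite hitE => Tt|move=> t0r Tt];
  exists t; rewrite // /hit_set/= hitE.
Qed.

Lemma lebesgue_measure_oblique_slice_detection_region th y : cos th != 0 ->
  (mu (oblique_slice (tan th) (detection_region T r th) y) =
  mu (oblique_slice (tan th) T y) +
    (r * `|cos th|)%:E * (\1_(dotp (- tan th, 1)%R @` T) y)%:E)%E.
Proof.
move=> cos0; rewrite oblique_slice_detection_region// indicE.
have [y_proj|y_proj] := pselect ((dotp (- tan th, 1) @` T) y).
  rewrite mem_set// mule1 lebesgue_measure_stretch//.
  - exact/oblique_slice_neq0.
  - exact: compact_oblique_slice.
  - exact: is_interval_oblique_slice.
have -> : oblique_slice (tan th) T y = set0.
  by apply/eqP; apply: contra_notT y_proj => /set0P/oblique_slice_neq0.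
rewrite memNset// mule0 adde0; congr (mu _).
by rewrite -subset0 => x [].
Qed.

Lemma area_detection_region th : cos th != 0 ->
  (area (detection_region T r th) =
  area T + (r * `|cos th|)%:E * mu (dotp (- tan th, 1)%R @` T))%E.
Proof.
move=> cos0; set proj := dotp _ @` T.
have m_proj : measurable proj.
  apply: compact_measurable; apply: continuous_compact => //.
  by apply: continuous_subspaceT; exact: continuous_dotp.
have mT : measurable T by exact: closed_measurable_plane.
have m_region : measurable (detection_region T r th).
  rewrite -ysection_detection_set.
  exact: measurable_ysection measurable_detection_set.
rewrite !(area_oblique_slice (tan th))//.
under eq_integral do rewrite lebesgue_measure_oblique_slice_detection_region//.
have rcos_ge0 : (0 <= (r * `|cos th|)%:E)%E by rewrite lee_fin mulr_ge0.
have m_indic : measurable_fun setT (fun y => (\1_proj y)%:E : \bar R).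
  by apply/measurable_EFinP; exact: measurable_indic.
rewrite ge0_integralD//.
- by rewrite ge0_integralZl// integral_indic// setIT.
- exact: measurable_fun_oblique_slice.
- by move=> y _; rewrite mule_ge0.
- exact: measurable_funeM.
Qed.

End detection_area.

Lemma cos_eq0_period (R : realType) (th : R) : 0 <= th < 2 * pi -> cos th = 0 ->
  th = pi / 2 \/ th = 3 * pi / 2.
Proof.
have pi0 := pi_gt0 R.
have pihalf : (pi / 2 : R) \in `[0, pi] by rewrite in_itv/=; lra.
move=> /andP[th0 th2] c0; have [thpi|thpi] := leP th pi.
  by left; apply: cos_inj => //; rewrite ?cos_pihalf// in_itv/= th0.
right; suff : 2 * pi - th = pi / 2 by lra.
apply: cos_inj => //; first by rewrite in_itv/=; lra.
by rewrite cos_pihalf cosB c0 mulr_natl sin2pi mulr0 mul0r addr0.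
Qed.

Lemma negligible_cos_eq0 (R : realType) :
  (@lebesgue_measure R).-negligible
    [set th | `[0, 2 * pi[%classic th /\ cos th = 0].
Proof.
have negl1 (x : R) : (@lebesgue_measure R).-negligible [set x].
  by apply/negligibleP => //; exact: lebesgue_measure_set1.
apply: negligibleS (negligibleU (negl1 (pi / 2)) (negl1 (3 * pi / 2))).
by move=> th [/=]; rewrite in_itv/=; exact: cos_eq0_period.
Qed.

Lemma vol3_angle_itv (R : realType) (A : set ((R * R) * R)) (i : interval R) :
  measurable A -> vol3 (A `&` snd @^-1` [set` i]) =
  (\int[@lebesgue_measure R]_(th in [set` i]) area (ysection A th))%E.
Proof.
move=> mA; rewrite vol3_ysection.
  rewrite [RHS]integral_mkcond; apply: eq_integral => th _.
  have slabE : ysection (@snd (R * R) R @^-1` [set` i]) th =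
      if th \in [set` i] then setT else set0.
    case: ifPn => th_i; apply/seteqP; split => p //=.
    by rewrite /ysection /= inE => i_th; case/negP: th_i; exact/mem_set.
  rewrite patchE ysectionI slabE; case: ifP => _; first by rewrite setIT.
  by rewrite setI0 [LHS]measure0.
apply: measurableI => //; rewrite -[X in measurable X]setTI.
by apply: measurable_snd => //; exact: measurable_itv.
Qed.

Section polygon_detection.
Variables (R : realType) (n : nat) (v : nat -> R * R).
Local Notation mu := (@lebesgue_measure R).
Local Notation next i := (i.+1 %% n)%N.
Local Notation T := (polygon n v).

Definition edge_shadow (k : nat) (th : R) : R :=
  `|dotp (- sin th, cos th) (v (next k) - v k)|.

Lemma edge_shadowE k th : edge_shadow k th =
  `|((v (next k)).2 - (v k).2) * cos th + ((v k).1 - (v (next k)).1) * sin th|.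
Proof. by rewrite /edge_shadow /dotp/=; congr `|_|; ring. Qed.

Lemma edge_shadow_sum_ge0 th : (0 <= \sum_(k < n) (edge_shadow k th)%:E)%E.
Proof. by apply: sume_ge0 => k _; rewrite lee_fin normr_ge0. Qed.

Lemma measurable_edge_shadow k (D : set R) :
  measurable_fun D (fun th => (edge_shadow k th)%:E).
Proof.
under eq_fun do rewrite edge_shadowE.
by apply: measurable_normr_continuous; exact: continuous_trig.
Qed.

Lemma measurable_edge_shadow_sum (D : set R) :
  measurable_fun D (fun th => \sum_(k < n) (edge_shadow k th)%:E)%E.
Proof. by apply: emeasurable_sum => k; exact: measurable_edge_shadow. Qed.

Lemma integral_edge_shadow_sum :
  (\int[mu]_(th in `[0%R, (2 * pi)%R[) \sum_(k < n) (edge_shadow k th)%:E =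
    (4 * perimeter n v)%:E)%E.
Proof.
rewrite ge0_integral_sum//; last 2 first.
- by move=> k; exact: measurable_edge_shadow.
- by move=> k th _; rewrite lee_fin normr_ge0.
rewrite /perimeter mulr_sumr -sumEFin; apply: eq_bigr => k _.
under eq_integral do rewrite edge_shadowE.
rewrite integral_normr_trig /dist2; congr (_ * Num.sqrt _)%:E; ring.
Qed.

Hypothesis cvx : convex_polygon_vertices n v.
Variable r : R.
Hypothesis r_ge0 : 0 <= r.

Lemma area_polygon_detection_region th : cos th != 0 ->
  (area (detection_region T r th) =
  area T + (2^-1 * r)%:E * \sum_(k < n) (edge_shadow k th)%:E)%E.
Proof.
move=> cos0; rewrite area_detection_region//;
  [|exact: compact_polygon|exact: convex_polygon].
congr (_ + _)%E; rewrite lebesgue_measure_dotp_polygon// sumEFin -!EFinM.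
have shadowE (k : 'I_n) : edge_shadow k th = `|cos th| *
    `|dotp (- tan th, 1) (v (next k)) - dotp (- tan th, 1) (v k)|.
  by rewrite -normrM; congr `|_|; rewrite /dotp /tan/=; field.
by rewrite (eq_bigr _ (fun k _ => shadowE k)) -mulr_sumr; congr EFin; ring.
Qed.

Lemma vol3_polygon_detection_set :
  (vol3 (detection_set T r `&` snd @^-1` `[0%R, (2 * pi)%R[) =
  (2 * pi)%:E * area T + (2 * r * perimeter n v)%:E)%E.
Proof.
have m_det : measurable (detection_set T r).
  exact: measurable_detection_set (@compact_polygon R n v).
have m_sum := measurable_edge_shadow_sum.
have sum_ge0 := edge_shadow_sum_ge0.
have r2_ge0 : (0 <= (2^-1 * r)%:E)%E by rewrite lee_fin mulr_ge0.
rewrite vol3_angle_itv//.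
transitivity (\int[mu]_(th in `[0%R, (2 * pi)%R[)
    (area T + (2^-1 * r)%:E * \sum_(k < n) (edge_shadow k th)%:E))%E.
  apply: ge0_ae_eq_integral => //.
  - apply: measurable_funTS.
    exact: (measurable_fun_ysection (@plane_measure R) m_det).
  - apply: emeasurable_funD; first exact: measurable_cst.
    exact: measurable_funeM (m_sum _).
  - by move=> th _; rewrite adde_ge0 ?measure_ge0// mule_ge0.
  - apply: negligibleS (negligible_cos_eq0 R) => th /= /not_implyP[th_itv].
    move=> area_neq; split=> //; apply/eqP; apply: contra_notT area_neq => cos0.
    by rewrite ysection_detection_set; exact: area_polygon_detection_region.
rewrite ge0_integralD//; last 2 first.
- by move=> th _; rewrite mule_ge0.
- exact: measurable_funeM (m_sum _).
rewrite ge0_integralZl//; last exact: m_sum.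
rewrite integral_edge_shadow_sum; congr (_ + _)%E.
  rewrite [LHS]integral_cst// muleC [X in (X * _)%E]lebesgue_measure_itv/=.
  by rewrite lte_fin mulr_gt0 ?pi_gt0// oppr0 addr0.
by rewrite -EFinM; congr EFin; field.
Qed.

End polygon_detection.

Theorem theorem1 (R : realType) (Omega : set (R * R)) (n : nat) (v : nat -> R * R)
  (rmax r : R) :
  measurable Omega ->
  (0 < area Omega)%E -> (area Omega < +oo)%E ->
  convex_polygon_vertices n v ->
  polygon n v `<=` Omega ->
  0 < rmax ->
  (forall p, (exists q, polygon n v q /\ dist2 p q <= rmax) -> Omega p) ->
  0 <= r -> r <= rmax ->
  prob_detect_le Omega (polygon n v) rmax r =
    ((r * perimeter n v + pi * fine (area (polygon n v))) / (pi * fine (area Omega)))%:E.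
Proof.
move=> mOmega Omega_gt0 Omega_fin cvx T_Omega _ near_Omega r_ge0 r_rmax.
set T := polygon n v; have closedT : closed T := @closed_polygon R n v.
have fin_Omega : area Omega \is a fin_num by rewrite ge0_fin_numE// ltW.
have fin_T : area T \is a fin_num.
  rewrite ge0_fin_numE ?measure_ge0//; apply: le_lt_trans Omega_fin.
  by apply: le_measure; rewrite ?inE//; exact: closed_measurable_plane.
rewrite /prob_detect_le detection_eventE// vol3_polygon_detection_set//.
rewrite -(fineK fin_T) -(fineK fin_Omega).
rewrite -!EFinM -EFinD inver.
have Omega0 : 0 < fine (area Omega) by rewrite fine_gt0// Omega_gt0.
have pi0 := pi_gt0 R.
rewrite gt_eqF ?mulr_gt0// -EFinM; congr EFin.
(* [field] would unfold [pi] to [_ *+ 2] *)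
by move: (@pi R) pi0 => p p0; field; rewrite !gt_eqF.
Qed.
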